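(* For every $c\in\mathbb{N}$ there exists a planar graph $G$ such that for every tree $T$ and every graph $H$, if $G$ is contained in $H\boxtimes T\boxtimes K_c$, then $K_4$ is contained in $H$ and $\operatorname{tw}(H)\geq 3$.
   Context: All graphs are finite, simple and undirected. The strong product $A\boxtimes B$ of graphs $A$ and $B$ has vertex set $V(A)\times V(B)$, where distinct vertices $(v,x),(w,y)$ are adjacent if ($v=w$ and $xy\in E(B)$) or ($x=y$ and $vw\in E(A)$) or ($vw\in E(A)$ and $xy\in E(B)$). A graph $H$ is contained in a graph $G$ if $H$ is isomorphic to a subgraph of $G$. $K_c$ is the complete graph on $c$ vertices. $\operatorname{tw}$ denotes treewidth. *)

(* Defs.v *)
From mathcomp Require Import all_boot.
From Stdlib Require Import Reals.

Set Implicit Arguments.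
Unset Strict Implicit.
Unset Printing Implicit Defensive.

Definition simple_graph (V : finType) (e : rel V) : Prop :=
  symmetric e /\ irreflexive e.

Definition strong (V W : finType) (eV : rel V) (eW : rel W) : rel (V * W) :=
  fun p q =>
    (p != q) &&
    [|| (p.1 == q.1) && eW p.2 q.2,
        (p.2 == q.2) && eV p.1 q.1
      | eV p.1 q.1 && eW p.2 q.2].

Definition Kc (c : nat) : rel 'I_c := fun i j => i != j.
Arguments Kc c : clear implicits.

Definition contained (VG : finType) (eG : rel VG) (VH : finType) (eH : rel VH) :
  Prop :=
  exists f : VG -> VH, injective f /\ forall x y, eG x y -> eH (f x) (f y).

Definition connected_graph (V : finType) (e : rel V) : Prop :=
  forall x y : V, connect e x y.

Definition acyclic (V : finType) (e : rel V) : Prop :=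
  forall s : seq V, uniq s -> 2 < size s -> ~~ cycle e s.

Definition is_tree (V : finType) (e : rel V) : Prop :=
  simple_graph e /\ 0 < #|V| /\ connected_graph e /\ acyclic e.

Definition tree_decomposition (VH : finType) (eH : rel VH)
  (VT : finType) (eT : rel VT) (B : VT -> {set VH}) : Prop :=
  is_tree eT /\
  (forall v : VH, exists t, v \in B t) /\
  (forall v w : VH, eH v w -> exists t, (v \in B t) && (w \in B t)) /\
  (forall (v : VH) (t1 t2 : VT), v \in B t1 -> v \in B t2 ->
     connect (fun a b => [&& eT a b, v \in B a & v \in B b]) t1 t2).

Definition tw_le (VH : finType) (eH : rel VH) (k : nat) : Prop :=
  exists (VT : finType) (eT : rel VT) (B : VT -> {set VH}),
    tree_decomposition eH eT B /\ forall t, #|B t| <= k.+1.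

Definition tw_ge (VH : finType) (eH : rel VH) (k : nat) : Prop :=
  forall k', tw_le eH k' -> k <= k'.

Local Open Scope R_scope.

Definition pt := (R * R)%type.

Definition dist2 (p q : pt) : R := Rmax (Rabs (fst p - fst q)) (Rabs (snd p - snd q)).

Definition in01 (t : R) : Prop := 0 <= t <= 1.
Definition in01o (t : R) : Prop := 0 < t < 1.

Definition arc (f : R -> pt) : Prop :=
  (forall t eps, in01 t -> 0 < eps -> exists delta, 0 < delta /\
     forall s, in01 s -> Rabs (s - t) < delta -> dist2 (f s) (f t) < eps) /\
  (forall s t, in01 s -> in01 t -> f s = f t -> s = t).

Definition planar (V : finType) (e : rel V) : Prop :=
  exists (pos : V -> pt) (curve : V -> V -> R -> pt),
    injective pos /\
    (forall x y, e x y ->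
       arc (curve x y) /\ curve x y 0 = pos x /\ curve x y 1 = pos y) /\
    (forall x y w t, e x y -> in01o t -> curve x y t <> pos w) /\
    (forall x y u v t s, e x y -> e u v ->
       [set x; y] != [set u; v] ->
       in01o t -> in01 s -> curve x y t <> curve u v s).

(* Main.v *)
(** Call an edge uv rich of order k+1 if u and v have many common neighbours x forming a
    path, with all edges ux and xv rich of order k.  Suppose a graph maps into H * T * K_c
    (strong product), and let h and t be the coordinates in H and T.  If an edge uv of
    order 1 has h(u) <> h(v) and t(u) <> t(v), then its common neighbours lie over t(u)
    and t(v), since a tree has no triangle; the fibres of h are bounded there, so two
    consecutive vertices x, y of the path have distinct h-values outside {h(u), h(v)},
    and h(u), h(v), h(x), h(y) span a K_4 in H.  If uv has order 2, h(u) <> h(v) and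
    t(u) = t(v), then either all common neighbours lie over t(u), and the same argument
    applies, or one of the edges ux, xv is of the previous kind.  So without a K_4 every
    edge of order 2 is h-constant; counting common neighbours, every edge of order 3 is
    also t-constant, and then a pair of order 4 has too many common neighbours over a
    single point of H * T.

    Rich edges occur in planar graphs: start from an empty triangle with corner pair a, b,
    repeatedly put a vertex w at the centroid, join it to the corners, and treat the three
    new empty triangles independently: one for the rest of the path, one each for making
    aw and wb rich.

    The treewidth bound holds because a K_4 lies in one bag, by the Helly property of
    subtrees. *)

Require Import Defs.
From mathcomp Require Import all_boot.
From Stdlib Require Import Reals Lra.

Set Implicit Arguments.
Unset Strict Implicit.
Unset Printing Implicit Defensive.

(** * Helly property of subtrees *)

Lemma first_hit (T : eqType) (s q : seq T) (x : T) :
  x \in s -> x \in q ->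
  exists m s1 s2, [/\ s = rcons s1 m ++ s2, m \in q & ~~ has (mem q) s1].
Proof.
move=> xs xq; have hs : has (mem q) s by apply/hasP; exists x.
by case: (split_find hs) => m s1 s2 mq dis; exists m, s1, s2.
Qed.

(** Drop the common first steps. Where the paths part, follow [p] to its first vertex [m] on [q] and
    come back along [q] reversed: this closes a cycle. *)
Lemma acyclic_path_inj (T : finType) (e : rel T) :
  symmetric e -> acyclic e ->
  forall p q a, path e a p -> path e a q -> uniq (a :: p) -> uniq (a :: q) ->
  last a p = last a q -> p = q.
Proof.
move=> e_sym eac; elim=> [|x p IHp] [|y q] a //.
- by move=> _ _ _ /andP[/negP aq _] eqa; case: aq; have := mem_last y q; rewrite -[last y q]/(last a (y :: q)) -eqa.
- by move=> _ _ /andP[/negP ap _] _ eqa; case: ap; have := mem_last x p; rewrite -[last x p]/(last a (x :: p)) eqa.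
have [<-|neq_xy] := eqVneq x y.
  move=> /andP[_ xp] /andP[_ xq] /andP[_ up] /andP[_ uq] eql.
  by congr (_ :: _); apply: IHp xp xq up uq eql.
move=> ep eq up uq eql; exfalso.
have lq : last x p \in y :: q by rewrite -[last x p]/(last a (x :: p)) eql; exact: (mem_last y q).
have [m [p1 [p2 [Ep mq dis]]]] := first_hit (mem_last x p) lq.
have [q1 [q2 Eq]] : exists q1 q2, y :: q = rcons q1 m ++ q2.
  by case/splitPr: mq => q1 q2; exists q1, q2; rewrite cat_rcons.
(* The cycle has [size p1 + size q1 + 2] vertices and needs at least three; if both pieces were
   empty, then [x = m = y]. *)
have neq : 0 < size p1 + size q1.
  case: p1 q1 Ep Eq {dis} => [|? ?] [|? ?] //= [Ex _] [Ey _].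
  by rewrite Ex Ey eqxx in neq_xy.
rewrite Ep cat_path in ep; rewrite Eq cat_path in eq.
have{ep} /andP[ep _] := ep; have{eq} /andP[eq _] := eq.
rewrite Ep -cat_cons cat_uniq in up; have{up} /andP[up _] := up.
have uq' := uq; rewrite Eq -cat_cons cat_uniq in uq'; have{uq'} /andP[uq' _] := uq'.
apply: (negP (eac (a :: rcons p1 m ++ rev q1) _ _)).
- rewrite -cat_cons cat_uniq up rev_uniq.
  move: uq'; rewrite /= mem_rcons rcons_uniq => /and3P[anq mnq ->]; rewrite andbT /=.
  apply/hasP => -[z]; rewrite mem_rev => zq1.
  rewrite /= !inE mem_rcons !inE => /or3P[] => [/eqP za|/eqP zm|zp1].
  + by rewrite -za inE zq1 orbT in anq.
  + by rewrite -zm zq1 in mnq.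
  + have /hasPn/(_ z zp1)/negP := dis; apply.
    by rewrite /= Eq mem_cat mem_rcons inE zq1 orbT.
- by rewrite /= size_cat size_rcons size_rev addSn !ltnS.
- rewrite /= rcons_cat cat_path ep last_rcons -rev_cons.
  have -> : a :: q1 = belast a (rcons q1 m) by rewrite belast_rcons.
  have {1}-> : m = last a (rcons q1 m) by rewrite last_rcons.
  rewrite rev_path -(eq_path (e := e)) //.
Qed.

(** Quantifying over all simple paths lets [helly3] argue from connectedness alone; acyclicity
    enters only through [connected_convex]. *)
Definition convex (T : finType) (e : rel T) (S : pred T) : Prop :=
  forall a p, path e a p -> uniq (a :: p) -> S a -> S (last a p) ->
  forall x, x \in p -> S x.

Lemma connect_simple_path (T : finType) (e : rel T) x y :
  connect e x y -> exists p, [/\ path e x p, uniq (x :: p) & last x p = y].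
Proof.
case/connectP => p ep ->; case/shortenP: ep => p' ep' up' _.
by exists p'.
Qed.

(** A simple path between two points of [S] exists inside [S], and simple paths are unique. *)
Lemma connected_convex (T : finType) (e : rel T) (S : pred T) :
  symmetric e -> acyclic e ->
  (forall a b, S a -> S b -> connect (fun x y => [&& e x y, S x & S y]) a b) ->
  convex e S.
Proof.
move=> e_sym eac conn a p ep up Sa Sb x xp.
have [q [eq uq eql]] := connect_simple_path (conn _ _ Sa Sb).
have eq' : path e a q by apply: sub_path eq => u v /and3P[].
have Epq := acyclic_path_inj e_sym eac ep eq' up uq (esym eql).
have {}xp : x \in q by rewrite -Epq.
case/splitPr: xp eq => q1 q2; rewrite cat_path /= => /and3P[_ /and3P[_ _ ->]].
by [].
Qed.

Lemma convexI (T : finType) (e : rel T) (S S' : pred T) :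
  convex e S -> convex e S' -> convex e (predI S S').
Proof.
move=> cS cS' a p ep up /andP[Sa S'a] /andP[Sb S'b] x xp /=.
by apply/andP; split; [exact: (cS a p) | exact: (cS' a p)].
Qed.

(* The median of x, y, z: the first vertex of the z-x path lying on the x-y path. *)
Lemma helly3 (T : finType) (e : rel T) (S1 S2 S3 : pred T) :
  connected_graph e -> convex e S1 -> convex e S2 -> convex e S3 ->
  (exists x, S1 x && S2 x) -> (exists y, S2 y && S3 y) -> (exists z, S1 z && S3 z) ->
  exists m, [&& S1 m, S2 m & S3 m].
Proof.
move=> conn c1 c2 c3 [x /andP[x1 x2]] [y /andP[y2 y3]] [z /andP[z1 z3]].
have [p [ep up lp]] := connect_simple_path (conn x y).
have [q [eq uq lq]] := connect_simple_path (conn z x).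
have xq : x \in z :: q by rewrite -lq mem_last.
have [m [q1 [q2 [Eq mp dis]]]] := first_hit xq (mem_head x p).
exists m; apply/and3P; split.
- have: m \in z :: q by rewrite Eq mem_cat mem_rcons mem_head.
  rewrite inE => /predU1P[->//|mq]; apply: (c1 z q) => //.
  by rewrite lq.
- move: mp; rewrite inE => /predU1P[->//|mp]; apply: (c2 x p) => //.
  by rewrite lp.
- case: q1 Eq dis => [[<-]//|_ q1 [<- Eq] dis].
  rewrite Eq in eq uq; move: eq; rewrite cat_path => /andP[eq _].
  move: uq; rewrite -cat_cons cat_uniq => /andP[uq _].
  case/splitPl: mp dis ep up lp => p1 p2 lm dis.
  rewrite cat_path lm last_cat lm => /andP[_ ep].
  rewrite -cat_cons cat_uniq => /and3P[_ dis2 up] lp.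
  (* No vertex before [m] lies on the x-y path, so going from [z] to [m] and on to [y] is a simple
     path between points of [S3]. *)
  apply: (c3 z (rcons q1 m ++ p2)) => //.
  + by rewrite cat_path eq last_rcons.
  + rewrite -cat_cons cat_uniq uq up andbT /=; apply/hasP => -[w wp2].
    rewrite -rcons_cons mem_rcons inE => /predU1P[wm|wq].
    * move/hasP: dis2; apply; exists w => //=; rewrite wm -lm; exact: mem_last.
    * move/hasPn: dis => /(_ w wq)/negP; apply.
      by rewrite /= inE mem_cat wp2 !orbT.
  + by rewrite last_cat last_rcons lp.
  + by rewrite mem_cat mem_rcons mem_head.
Qed.

(** Apply Helly to the subtrees of [a], [b], [c], each cut down to that of [d]; these meet pairwise
    by Helly for the three triangles through [d]. *)
Lemma K4_in_bag (VH : finType) (eH : rel VH) (VT : finType) (eT : rel VT)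
    (B : VT -> {set VH}) (a b c d : VH) :
  tree_decomposition eH eT B ->
  eH a b -> eH a c -> eH a d -> eH b c -> eH b d -> eH c d ->
  exists t, [&& a \in B t, b \in B t, c \in B t & d \in B t].
Proof.
move=> [[[e_sym _] [_ [conn eac]]] [_ [Bedge Bconn]]] ab ac ad bc bd cd.
pose S v := [pred t | v \in B t].
have cS v : convex eT (S v) by apply: connected_convex => // t1 t2; apply: Bconn.
have h3 x y z : eH x y -> eH x z -> eH y z ->
    exists t, [&& x \in B t, y \in B t & z \in B t].
  by move=> xy xz yz; apply: (helly3 conn (cS x) (cS y) (cS z)); exact: Bedge.
have [|||t] := helly3 conn (convexI (cS a) (cS d)) (convexI (cS b) (cS d))
                 (convexI (cS c) (cS d)).
- by have [t /and3P[ta tb td]] := h3 _ _ _ ab ad bd; exists t; rewrite /= ta tb td.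
- by have [t /and3P[ta tb td]] := h3 _ _ _ bc bd cd; exists t; rewrite /= ta tb td.
- by have [t /and3P[ta tb td]] := h3 _ _ _ ac ad cd; exists t; rewrite /= ta tb td.
move=> /and3P[/andP[ta td] /andP[tb _] /andP[tc _]].
by exists t; apply/and4P.
Qed.

Lemma K4_tw_ge (VH : finType) (eH : rel VH) (a b c d : VH) :
  irreflexive eH ->
  eH a b -> eH a c -> eH a d -> eH b c -> eH b d -> eH c d -> tw_ge eH 3.
Proof.
move=> eirr ab ac ad bc bd cd k [VT [eT [B [tdB Bk]]]].
have neq x y : eH x y -> (x == y) = false.
  by move=> xy; apply/eqP => E; rewrite E eirr in xy.
have [t /and4P[ta tb tc td]] := K4_in_bag tdB ab ac ad bc bd cd.
rewrite -ltnS; apply: leq_trans (Bk t).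
have <- : #|[:: a; b; c; d]| = 4 by apply/card_uniqP; rewrite /= !inE !neq.
apply/subset_leq_card/subsetP => x.
by rewrite !inE => /or4P[] /eqP ->.
Qed.

Lemma K4_contained (VH : finType) (eH : rel VH) (a b c d : VH) :
  simple_graph eH ->
  eH a b -> eH a c -> eH a d -> eH b c -> eH b d -> eH c d -> contained (Kc 4) eH.
Proof.
move=> [e_sym eirr] ab ac ad bc bd cd.
pose f (i : 'I_4) := tnth [tuple a; b; c; d] i.
have fe i j : i != j -> eH (f i) (f j).
  by case: i j => [[|[|[|[|//]]]] ?] [[|[|[|[|//]]]] ?] // _;
    rewrite /f !(tnth_nth a) //= e_sym.
exists f; split; last exact: fe.
move=> i j Ef; apply/eqP; apply: contraT => /fe.
by rewrite Ef eirr.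
Qed.

(** * Rich edges in strong products *)

(** The pair itself may be non-adjacent, like the two starting corners of the drawing; adjacency is
    a separate hypothesis where it matters. *)
Fixpoint rich (V : eqType) (E : rel V) (N k : nat) (u v : V) : Prop :=
  if k is k'.+1 then
    exists p : seq V,
      [/\ size p = N, uniq p, sorted E p &
          forall x, x \in p -> [/\ E u x, E x v, rich E N k' u x & rich E N k' x v]]
  else True.

Definition adj_or_eq (V : eqType) (e : rel V) (x y : V) : bool := (x == y) || e x y.

(** What an embedding leaves once the [K_c] coordinate is forgotten: injectivity survives as the
    bound on fibres. *)
Definition product_coords (V : eqType) (E : rel V) (VH : finType) (eH : rel VH)
    (VT : finType) (eT : rel VT) (c : nat) (h : V -> VH) (t : V -> VT) : Prop :=
  (forall x y, E x y -> adj_or_eq eH (h x) (h y) && adj_or_eq eT (t x) (t y)) /\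
  (forall (z : VH) (S : {set VT}) (p : seq V), uniq p ->
     (forall x, x \in p -> h x = z /\ t x \in S) -> size p <= #|S| * c).

Lemma embedding_product_coords (V : finType) (E : rel V) (VH : finType) (eH : rel VH)
    (VT : finType) (eT : rel VT) (c : nat) (f : V -> VH * VT * 'I_c) :
  injective f -> (forall x y, E x y -> strong (strong eH eT) (Kc c) (f x) (f y)) ->
  product_coords E eH eT c (fun x => (f x).1.1) (fun x => (f x).1.2).
Proof.
move=> finj fE; split=> [x y /fE|z S p up pS].
  rewrite /strong /adj_or_eq; case: (f x) (f y) => [[h1 t1] k1] [[h2 t2] k2] /=.
  move=> /andP[_ /or3P[/andP[/eqP[-> ->] _]|/andP[_]|/andP[+ _]]]; first by rewrite !eqxx.
  - by move=> /andP[_ /or3P[/andP[-> ->]|/andP[-> ->]|/andP[-> ->]]]; rewrite !orbT.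
  - by move=> /andP[_ /or3P[/andP[-> ->]|/andP[-> ->]|/andP[-> ->]]]; rewrite !orbT.
rewrite -(size_map f) -(card_uniqP _) ?map_inj_uniq //.
have -> : #|S| * c = #|setX (setX [set z] S) [set: 'I_c]|.
  by rewrite !cardsX cards1 mul1n cardsT card_ord.
apply/subset_leq_card/subsetP => _ /mapP[x /pS[hx tx] ->].
by rewrite !inE hx eqxx tx.
Qed.

Definition has_K4 (V : finType) (e : rel V) : Prop :=
  exists a b c d, [/\ e a b, e a c, e a d & [/\ e b c, e b d & e c d]].

(** Pigeonhole over [B.+1] consecutive blocks of length [M]: each block that fails uses up one of
    the at most [B] bad entries. *)
Lemma good_block (V : eqType) (E : rel V) (bad : pred V) (M B : nat) (p : seq V) :
  sorted E p -> uniq p -> count bad p <= B -> B.+1 * M <= size p ->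
  exists q, [/\ sorted E q, uniq q, size q = M & forall x, x \in q -> x \in p /\ ~~ bad x].
Proof.
elim: B p => [|B IHB] p sp up cp Mp.
all: have Mp' : M <= size p by apply: leq_trans Mp; rewrite leq_pmull.
all: have [hasb|nhasb] := boolP (has bad (take M p)).
all: try by exists (take M p); rewrite take_sorted ?take_uniq ?size_takel //; split=> // x xq;
  split; [exact: mem_take xq | exact: (hasPn nhasb)].
  by move: cp hasb; rewrite -{1}(cat_take_drop M p) count_cat has_count leqn0 addn_eq0 => /andP[/eqP->].
have [||||q [sq uq eq qp]] := IHB (drop M p); rewrite ?drop_sorted ?drop_uniq //.
- move: cp; rewrite -{1}(cat_take_drop M p) count_cat; rewrite has_count in hasb.
  by move=> cp; rewrite -ltnS; apply: leq_trans cp; rewrite -add1n leq_add2r.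
- by rewrite size_drop leq_subRL // -mulSn.
by exists q; split=> // x /qp[/mem_drop].
Qed.

Lemma path_step (V U : eqType) (E : rel V) (h : V -> U) (x y : V) (q : seq V) :
  path E x q -> y \in q -> h y != h x ->
  exists a b, [/\ a \in x :: q, b \in x :: q, E a b & h a != h b].
Proof.
elim: q x => [|z q IHq] x //= /andP[xz zq] yq hyx.
have [hzx|hzx] := eqVneq (h z) (h x).
  move: yq; rewrite inE => /predU1P[yz|yq]; first by rewrite yz hzx eqxx in hyx.
  rewrite -hzx in hyx; have [a [b [aq bq ab hab]]] := IHq z zq yq hyx.
  by exists a, b; split=> //; rewrite inE ?aq ?bq orbT.
by exists x, z; rewrite eq_sym; split=> //; rewrite !inE eqxx ?orbT.
Qed.

(* 4c + 1 blocks of 2c + 1 consecutive vertices: at most 4c common neighbours share their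
   h-value with u or v, so one block avoids both values. *)
Definition ladder_length (c : nat) : nat := (4 * c).+1 * (2 * c).+1.

Lemma ladder_lengthP (c : nat) : 2 * c < ladder_length c.
Proof. by rewrite leq_pmull. Qed.

Lemma ladder_K4 (V : eqType) (E : rel V) (VH : finType) (eH : rel VH)
    (VT : finType) (eT : rel VT) (c : nat) (h : V -> VH) (t : V -> VT)
    (u v : V) (p : seq V) (S : {set VT}) :
  product_coords E eH eT c h t -> E u v -> h u != h v ->
  size p = ladder_length c -> uniq p -> sorted E p -> #|S| <= 2 ->
  (forall x, x \in p -> [/\ E u x, E x v & t x \in S]) -> has_K4 eH.
Proof.
move=> [hom fib] uv huv sp up ep S2 pP.
have fib2 z q : uniq q -> (forall x, x \in q -> h x = z /\ t x \in S) -> size q <= 2 * c.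
  by move=> uq qP; apply: leq_trans (fib z S q uq qP) _; rewrite leq_mul2r S2 orbT.
have eHP x y : E x y -> h x != h y -> eH (h x) (h y).
  by move=> /hom/andP[/predU1P[->|//] _]; rewrite eqxx.
pose bad x := (h x == h u) || (h x == h v).
have cnt z : count (fun x => h x == z) p <= 2 * c.
  rewrite -size_filter; apply: (fib2 z); first exact: filter_uniq.
  by move=> x; rewrite mem_filter => /andP[/eqP -> /pP[]].
have [||q [eq uq sq qP]] := good_block (bad := bad) (M := (2 * c).+1) (B := 4 * c) ep up.
- rewrite -[4]/(2 + 2) mulnDl; apply: leq_trans (leq_add (cnt (h u)) (cnt (h v))).
  by rewrite -count_predUI leq_addr.
- by rewrite sp.
case: q sq eq uq qP => // x q sq eq uq qP.
(* The block has [2 * c + 1] vertices over at most two tree nodes, too many for one value of [h]; so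
   [h] changes along some edge of the block. *)
have [/allP qh|] := boolP (all (fun y => h y == h x) q).
  have : size (x :: q) <= 2 * c.
    apply: (fib2 (h x)) => // y yq; split; last by have [/pP[_ _ ?] _] := qP y yq.
    by move: yq; rewrite inE => /predU1P[->|yq] //; apply/eqP/qh.
  by rewrite sq ltnn.
rewrite -has_predC => /hasP[y yq /= hyx].
have [a [b [aq bq ab hab]]] := path_step eq yq hyx.
have [/pP[ua av _] /norP[hau hav]] := qP a aq.
have [/pP[ub bv _] /norP[hbu hbv]] := qP b bq.
by exists (h u), (h a), (h b), (h v); rewrite !eHP // eq_sym.
Qed.

(* A tree has no triangle, so a common neighbour of two vertices lying over distinct
   tree nodes lies over one of these two nodes. *)
Lemma tree_common_nbr (V : eqType) (E : rel V) (VH : finType) (eH : rel VH)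
    (VT : finType) (eT : rel VT) (c : nat) (h : V -> VH) (t : V -> VT) (u v x : V) :
  product_coords E eH eT c h t -> is_tree eT -> E u v -> E u x -> E x v ->
  t u != t v -> t x \in [set t u; t v].
Proof.
move=> [hom _] [[e_sym _] [_ [_ eac]]] /hom/andP[_ uv] /hom/andP[_ ux] /hom/andP[_ xv] tuv.
rewrite !inE; apply: contraT => /norP[txu txv].
have := eac [:: t u; t x; t v]; rewrite /= !inE (eq_sym (t u)) (negPf txu) (negPf tuv) txv /=.
move: uv ux xv; rewrite /adj_or_eq (negPf tuv) eq_sym (negPf txu) (negPf txv) /=.
by move=> uv -> ->; rewrite e_sym uv => /(_ isT isT).
Qed.

Lemma rich_K4_across (V : eqType) (E : rel V) (VH : finType) (eH : rel VH)
    (VT : finType) (eT : rel VT) (c k : nat) (h : V -> VH) (t : V -> VT) (u v : V) :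
  product_coords E eH eT c h t -> is_tree eT ->
  E u v -> rich E (ladder_length c) k.+1 u v -> h u != h v -> t u != t v -> has_K4 eH.
Proof.
move=> coords tree uv [p [sp up ep pP]] huv tuv.
apply: (ladder_K4 (S := [set t u; t v]) coords uv huv sp up ep).
  by rewrite cards2 tuv.
by move=> x /pP[ux xv _ _]; split=> //; exact: (tree_common_nbr coords tree uv).
Qed.

Lemma rich_K4 (V : eqType) (E : rel V) (VH : finType) (eH : rel VH)
    (VT : finType) (eT : rel VT) (c k : nat) (h : V -> VH) (t : V -> VT) (u v : V) :
  product_coords E eH eT c h t -> is_tree eT ->
  E u v -> rich E (ladder_length c) k.+2 u v -> h u != h v -> has_K4 eH.
Proof.
move=> coords tree uv ruv huv.
have [tuv|tuv] := eqVneq (t u) (t v); last exact: (rich_K4_across coords tree uv ruv).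
have [p [sp up ep pP]] := ruv.
have [/allP tp|] := boolP (all (fun x => t x == t u) p).
  apply: (ladder_K4 (S := [set t u]) coords uv huv sp up ep).
    by rewrite cards1.
  by move=> x xp; have [ux xv _ _] := pP x xp; rewrite inE tp.
(* Here [x] lies off the common tree node of [u] and [v]. Since [h x] differs from [h u] or from
   [h v], one of the edges [ux], [xv] changes both coordinates. *)
rewrite -has_predC => /hasP[x xp /= txu]; have [ux xv rux rxv] := pP x xp.
have [hxu|hxu] := eqVneq (h x) (h u).
  by apply: (rich_K4_across coords tree xv rxv); rewrite ?hxu -?tuv.
by apply: (rich_K4_across coords tree ux rux); rewrite eq_sym.
Qed.

Lemma rich_edge_K4 (V : eqType) (E : rel V) (VH : finType) (eH : rel VH)
    (VT : finType) (eT : rel VT) (c k : nat) (h : V -> VH) (t : V -> VT) (u v : V) :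
  product_coords E eH eT c h t -> is_tree eT ->
  E u v -> rich E (ladder_length c) k.+3 u v ->
  (h u, t u) != (h v, t v) -> has_K4 eH.
Proof.
move=> coords tree uv ruv; rewrite xpair_eqE negb_and.
have [huv /= tuv|huv _] := eqVneq (h u) (h v); last exact: (rich_K4 coords tree uv ruv).
have [p [sp up _ pP]] := ruv.
(* If [h] were constant on [p], more than [2 * c] vertices would share one value of [h] over the two
   nodes [t u], [t v]. *)
have [/allP hp|] := boolP (all (fun x => h x == h u) p).
  have := ladder_lengthP c; rewrite -sp ltnNge => /negP[].
  apply: (@leq_trans (#|[set t u; t v]| * c)); last by rewrite cards2 tuv.
  apply: (coords.2 (h u)) => // x xp; have [ux xv _ _] := pP x xp.
  by rewrite (eqP (hp x xp)); split=> //; exact: (tree_common_nbr coords tree uv).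
rewrite -has_predC => /hasP[x xp /= hxu]; have [ux _ rux _] := pP x xp.
by apply: (rich_K4 coords tree ux rux); rewrite eq_sym.
Qed.

Lemma very_rich_K4 (V : eqType) (E : rel V) (VH : finType) (eH : rel VH)
    (VT : finType) (eT : rel VT) (c : nat) (h : V -> VH) (t : V -> VT) (u v : V) :
  product_coords E eH eT c h t -> is_tree eT ->
  rich E (ladder_length c) 4 u v -> has_K4 eH.
Proof.
move=> coords tree [p [sp up _ pP]].
have [/allP hp|] := boolP (all (fun x => (h u, t u) == (h x, t x)) p).
  have := ladder_lengthP c; rewrite -sp ltnNge => /negP[].
  apply: (@leq_trans (#|[set t u]| * c)); last by rewrite cards1 leq_mul2r orbT.
  apply: (coords.2 (h u)) => // x xp.
  by have /eqP[-> ->] := hp x xp; rewrite inE eqxx.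
rewrite -has_predC => /hasP[x xp /= hxu]; have [ux _ rux _] := pP x xp.
exact: (rich_edge_K4 (k := 0) coords tree ux rux).
Qed.

(** Drawings live on natural numbers, the final graph on a finite type. Every path vertex is an
    endpoint of an edge, hence below [n], so [pmap insub] drops nothing. *)
Lemma rich_ord (n : nat) (E : rel nat) (N k : nat) (u v : 'I_n) :
  (forall x y, E x y -> x < n /\ y < n) ->
  rich E N k u v -> rich (fun x y : 'I_n => E x y) N k u v.
Proof.
move=> En; elim: k u v => [|k IHk] u v //= [p [sp up ep pP]].
have pn : all (fun x => x < n) p by apply/allP => x /pP[/En[]].
have Ep : map val (pmap (insub : nat -> option 'I_n) p) = p.
  by rewrite (pmap_filter (@insubK _ _ _)) -[RHS]filter_predT; apply: eq_in_filter => x xp;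
     rewrite isSome_insub (allP pn).
exists (pmap insub p); split.
- by rewrite -sp -{2}Ep size_map.
- by rewrite -(map_inj_uniq val_inj) Ep.
- by rewrite -Ep sorted_map in ep.
- by move=> x; rewrite -(mem_map val_inj) Ep => /pP[? ? ? ?]; split=> //; exact: IHk.
Qed.

(** * Straight-line drawings *)

(** Twice the signed area of the triangle [a b p]. The values [det b c p], [det c a p], [det a b p]
    are the barycentric coordinates of [p] at [a], [b], [c], scaled by [det a b c]. *)
Definition det (a b p : pt) : R :=
  ((b.1 - a.1) * (p.2 - a.2) - (b.2 - a.2) * (p.1 - a.1))%R.

Definition open_triangle (a b c p : pt) : Prop :=
  (0 < det a b p)%R /\ (0 < det b c p)%R /\ (0 < det c a p)%R.

Definition centroid (a b c : pt) : pt :=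
  ((a.1 + b.1 + c.1) / 3, (a.2 + b.2 + c.2) / 3)%R.

Definition segment (a b : pt) (t : R) : pt :=
  ((1 - t) * a.1 + t * b.1, (1 - t) * a.2 + t * b.2)%R.

Definition open_segment (a b p : pt) : Prop := exists2 t, in01o t & p = segment a b t.

Lemma segment0 (a b : pt) : segment a b 0 = a.
Proof. by case: a => x y; rewrite /segment /=; congr pair; ring. Qed.

Lemma segment1 (a b : pt) : segment a b 1 = b.
Proof. by case: b => x y; rewrite /segment /=; congr pair; ring. Qed.

Lemma segment_sym (a b : pt) (t : R) : segment a b t = segment b a (1 - t).
Proof. by rewrite /segment; congr pair; ring. Qed.

Lemma open_segment_sym (a b p : pt) : open_segment a b p -> open_segment b a p.
Proof. by case=> t [t0 t1] ->; exists (1 - t)%R; [split; lra | exact: segment_sym]. Qed.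

Lemma det_rot (a b c : pt) : det b c a = det a b c.
Proof. by rewrite /det; ring. Qed.

Lemma centroid_rot (a b c : pt) : centroid b c a = centroid a b c.
Proof. by rewrite /centroid; congr pair; lra. Qed.

Lemma det_centroid (a b c : pt) (w := centroid a b c) :
  [/\ det a b w = det a b c / 3, det b c w = det a b c / 3 & det c a w = det a b c / 3]%R.
Proof. by split; rewrite /det /w /centroid /=; field. Qed.

(** The lines joining the centroid to [a] and to [b] are those on which two barycentric coordinates
    agree. *)
Lemma open_triangle_centroid (a b c p : pt) :
  open_triangle a b (centroid a b c) p <->
  (0 < det a b p < det b c p /\ det a b p < det c a p)%R.
Proof.
have E1 : det b (centroid a b c) p = ((det b c p - det a b p) / 3)%R.
  by rewrite /det /centroid /=; field.
have E2 : det (centroid a b c) a p = ((det c a p - det a b p) / 3)%R.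
  by rewrite /det /centroid /=; field.
rewrite /open_triangle E1 E2; lra.
Qed.

Lemma open_triangle_rotE (a b c p : pt) : open_triangle b c a p <-> open_triangle a b c p.
Proof. by rewrite /open_triangle; tauto. Qed.

(* The three triangles cut off by the centroid, told apart by the smallest barycentric
   coordinate. *)
Lemma centroid_triangles (a b c p : pt) (w := centroid a b c) :
  [/\ open_triangle a b w p <-> (0 < det a b p < det b c p /\ det a b p < det c a p)%R,
      open_triangle w b c p <-> (0 < det b c p < det c a p /\ det b c p < det a b p)%R &
      open_triangle a w c p <-> (0 < det c a p < det a b p /\ det c a p < det b c p)%R].
Proof.
split; first exact: open_triangle_centroid.
- by rewrite -open_triangle_rotE /w -centroid_rot; exact: open_triangle_centroid.
- rewrite open_triangle_rotE /w -2!centroid_rot.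
  by rewrite -open_triangle_centroid open_triangle_rotE.
Qed.

(** Moving from the centroid towards [a] keeps the coordinates at [b] and [c] equal and raises the
    one at [a]. *)
Lemma spokeP (a b c p : pt) :
  (0 < det a b c)%R -> open_segment (centroid a b c) a p ->
  (det c a p = det a b p /\ 0 < det a b p < det b c p)%R.
Proof.
move=> D0 [t [t0 t1] ->].
have -> : det c a (segment (centroid a b c) a t) = ((1 - t) * (det a b c / 3))%R.
  by rewrite /det /centroid /segment /=; field.
have -> : det a b (segment (centroid a b c) a t) = ((1 - t) * (det a b c / 3))%R.
  by rewrite /det /centroid /segment /=; field.
have -> : det b c (segment (centroid a b c) a t)
          = ((1 - t) * (det a b c / 3) + t * det a b c)%R.
  by rewrite /det /centroid /segment /=; field.
by split=> //; split; nra.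
Qed.

(** * Plane drawings and stacking a vertex into an empty triangle *)

Record drawing := Drawing {
  order : nat;
  place : nat -> pt;
  edge : rel nat }.

Definition plane_drawing (G : drawing) : Prop :=
  [/\ forall x y, edge G x y -> [/\ x < order G, y < order G & x != y],
      symmetric (edge G),
      forall x y, x < order G -> y < order G -> place G x = place G y -> x = y,
      forall x y z p, edge G x y -> z < order G ->
        open_segment (place G x) (place G y) p -> p <> place G z &
      forall x y u v p, edge G x y -> edge G u v ->
        open_segment (place G x) (place G y) p ->
        open_segment (place G u) (place G v) p -> (x = u /\ y = v) \/ (x = v /\ y = u)].

Definition drawn (G : drawing) (p : pt) : Prop :=
  (exists2 x, x < order G & p = place G x) \/
  (exists x y, edge G x y /\ open_segment (place G x) (place G y) p).

(** [S] confines everything newly drawn, so that empty triangles disjoint from [S] stay empty. *)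
Definition extends (G G' : drawing) (S : pt -> Prop) : Prop :=
  [/\ order G <= order G',
      forall x, x < order G -> place G' x = place G x,
      forall x y, edge G x y -> edge G' x y &
      forall p, drawn G' p -> drawn G p \/ S p].

(** The corners are in counter-clockwise order, and the sides need not be edges. The coordinates are
    parameters so that the triangle stays the same while the drawing grows. *)
Definition face (G : drawing) (a b c : nat) (A B C : pt) : Prop :=
  [/\ [/\ a < order G, b < order G & c < order G],
      [/\ place G a = A, place G b = B & place G c = C],
      (0 < det A B C)%R &
      forall p, drawn G p -> ~ open_triangle A B C p].

Lemma extends_refl (G : drawing) (S : pt -> Prop) : extends G G S.
Proof. by split=> // p; left. Qed.

Lemma extends_trans (G G' G'' : drawing) (S S' : pt -> Prop) :
  extends G G' S -> extends G' G'' S' -> (forall p, S' p -> S p) -> extends G G'' S.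
Proof.
move=> [n1 p1 e1 d1] [n2 p2 e2 d2] sS; split=> [|x xn|x y /e1/e2 //|p].
- exact: leq_trans n1 n2.
- by rewrite p2 ?p1 //; exact: leq_trans xn n1.
- by move=> /d2[/d1//|/sS]; right.
Qed.

Lemma face_extends (G G' : drawing) (S : pt -> Prop) a b c A B C :
  face G a b c A B C -> extends G G' S ->
  (forall p, open_triangle A B C p -> ~ S p) -> face G' a b c A B C.
Proof.
move=> [[an bn cn] [aA bB cC] D0 emp] [nn pp _ dd] dis; split=> //.
- by split; [move: an|move: bn|move: cn] => /leq_trans; apply.
- by rewrite !pp.
- by move=> p /dd[/emp//|Sp tp]; exact: dis tp Sp.
Qed.

(** The new vertex takes the number [order G], so older vertices keep their names. *)
Definition stack (G : drawing) (a b c : nat) : drawing :=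
  Drawing (order G).+1
    (fun x => if x == order G then centroid (place G a) (place G b) (place G c)
              else place G x)
    (fun x y => [|| edge G x y, (x == order G) && (y \in [:: a; b; c])
                  | (y == order G) && (x \in [:: a; b; c])]).

(** On a spoke the two smallest coordinates tie, and the third singles out the corner. So spokes are
    disjoint from one another and from the three new triangles, where the minimum is strict. *)
Lemma spoke_cases (G : drawing) a b c A B C z p :
  face G a b c A B C -> z \in [:: a; b; c] -> open_segment (centroid A B C) (place G z) p ->
  (0 < det A B p /\ 0 < det B C p /\ 0 < det C A p)%R /\
  [\/ z = a /\ (det C A p = det A B p /\ det A B p < det B C p)%R,
      z = b /\ (det A B p = det B C p /\ det B C p < det C A p)%R |
      z = c /\ (det B C p = det C A p /\ det C A p < det A B p)%R].
Proof.
move=> [_ [aA bB cC] D0 _]; rewrite !inE => /or3P[] /eqP ->.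
- rewrite aA => /spokeP[] // E1 L.
  by split; [lra | constructor 1; split=> //; lra].
- rewrite bB -centroid_rot => /spokeP[]; first by rewrite det_rot.
  move=> E1 L; by split; [lra | constructor 2; split=> //; lra].
- rewrite cC -2!centroid_rot => /spokeP[]; first by rewrite 2!det_rot.
  move=> E1 L; by split; [lra | constructor 3; split=> //; lra].
Qed.

Lemma stack_segment (G : drawing) a b c A B C x y p :
  plane_drawing G -> face G a b c A B C ->
  edge (stack G a b c) x y ->
  open_segment (place (stack G a b c) x) (place (stack G a b c) y) p ->
  (edge G x y /\ open_segment (place G x) (place G y) p) \/
  exists z, [/\ z \in [:: a; b; c], open_segment (centroid A B C) (place G z) p &
                (x = order G /\ y = z) \/ (x = z /\ y = order G)].
Proof.
move=> [En _ _ _ _] [[an bn cn] [aA bB cC] _ _] /=.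
have zn z : z \in [:: a; b; c] -> (z == order G) = false.
  by move=> zabc; apply/negbTE; rewrite neq_ltn; move: zabc; rewrite !inE => /or3P[] /eqP->;
     rewrite ?an ?bn ?cn.
case/or3P => [xy|/andP[/eqP-> yz]|/andP[/eqP-> xz]].
- have [xn yn _] := En x y xy.
  by rewrite !ltn_eqF //; left.
- by rewrite eqxx zn // aA bB cC => seg; right; exists y; split=> //; left.
- rewrite eqxx zn // aA bB cC => /open_segment_sym seg.
  by right; exists x; split=> //; right.
Qed.

Lemma stack_drawn (G : drawing) a b c A B C p :
  plane_drawing G -> face G a b c A B C -> drawn (stack G a b c) p ->
  [\/ drawn G p, p = centroid A B C |
      exists2 z, z \in [:: a; b; c] & open_segment (centroid A B C) (place G z) p].
Proof.
move=> pG fG [[x xn ->]|[x [y [xy seg]]]].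
  rewrite /=; case: eqP xn => [->|/eqP neq] xn.
    by have [_ [-> -> ->] _ _] := fG; constructor 2.
  by constructor 1; left; exists x => //; rewrite ltn_neqAle neq -ltnS.
have [[xy' seg']|[z [zabc seg' _]]] := stack_segment pG fG xy seg.
  by constructor 1; right; exists x, y.
by constructor 3; exists z.
Qed.

Lemma open_triangle_centroid_self (a b c : pt) :
  (0 < det a b c)%R -> open_triangle a b c (centroid a b c).
Proof.
by move=> D0; have [D1 D2 D3] := det_centroid a b c; rewrite /open_triangle; lra.
Qed.

Lemma stack_extends (G : drawing) a b c A B C :
  plane_drawing G -> face G a b c A B C ->
  extends G (stack G a b c) (open_triangle A B C).
Proof.
move=> pG fG; have [_ _ D0 _] := fG; split=> /=.
- exact: leqnSn.
- by move=> x xn; rewrite ltn_eqF.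
- by move=> x y ->.
- move=> p /(stack_drawn pG fG)[|->|[z zabc seg]]; first by left.
    by right; exact: open_triangle_centroid_self.
  by have [pos _] := spoke_cases fG zabc seg; right.
Qed.

(** Everything new lies in the open triangle, which contains nothing drawn before; only new objects
    can conflict, and [spoke_cases] separates these. *)
Lemma stack_plane (G : drawing) a b c A B C :
  plane_drawing G -> face G a b c A B C -> plane_drawing (stack G a b c).
Proof.
move=> pG fG; have [En E_sym inj ev ee] := pG.
have [[an bn cn] [aA bB cC] D0 emp] := fG.
have zn z : z \in [:: a; b; c] -> z < order G.
  by rewrite !inE => /or3P[] /eqP->.
have tw := open_triangle_centroid_self D0.
have drawn_pos x : x < order G -> drawn G (place G x) by move=> xn; left; exists x.
have drawn_seg x y p : edge G x y -> open_segment (place G x) (place G y) p -> drawn G p.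
  by move=> xy seg; right; exists x, y.
have spoke_in z p : z \in [:: a; b; c] -> open_segment (centroid A B C) (place G z) p ->
    open_triangle A B C p.
  by move=> zabc seg; have [] := spoke_cases fG zabc seg.
have old k : k < (order G).+1 -> k != order G -> k < order G.
  by rewrite ltnS ltn_neqAle => -> ->.
split=> [x y|x y|x y|x y k p xy|x y u v p xy uv].
- case/or3P => [/En[xn yn ->]|/andP[/eqP-> /zn yn]|/andP[/eqP-> /zn xn]].
  + by rewrite /= !ltnS (ltnW xn) (ltnW yn).
  + by rewrite /= !ltnS leqnn (ltnW yn) gtn_eqF.
  + by rewrite /= !ltnS leqnn (ltnW xn) ltn_eqF.
- by rewrite /= E_sym; congr (_ || _); exact: orbC.
- rewrite /= aA bB cC => xn yn.
  have [->|/(old x xn) {}xn] := eqVneq x (order G);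
  have [->|/(old y yn) {}yn] := eqVneq y (order G); move=> // Ew.
  + by case: (emp _ (drawn_pos y yn)); rewrite -Ew.
  + by case: (emp _ (drawn_pos x xn)); rewrite Ew.
  + exact: inj.
- move=> kn /(stack_segment pG fG xy).
  have [kG|neq] := eqVneq k (order G).
    rewrite /= kG eqxx aA bB cC => -[[xy' seg]|[z [zabc seg _]]] Ep.
      by case: (emp _ (drawn_seg _ _ _ xy' seg)); rewrite Ep.
    have [_] := spoke_cases fG zabc seg; rewrite Ep.
    (* At the centroid all three coordinates agree, while on a spoke one is strictly larger. *)
    have [-> -> ->] := det_centroid A B C.
    by case; lra.
  rewrite /= (negPf neq); have {}kn := old k kn neq.
  case=> [[xy' seg]|[z [zabc seg _]]]; first exact: ev xy' kn seg.
  by move=> Ep; case: (emp _ (drawn_pos k kn)); rewrite -Ep; exact: spoke_in seg.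
- move=> /(stack_segment pG fG xy)[[xy' seg]|[z [zabc seg Exy]]]
         /(stack_segment pG fG uv)[[uv' seg']|[z' [zabc' seg' Euv]]].
  + exact: ee seg seg'.
  + by case: (emp _ (drawn_seg _ _ _ xy' seg)); exact: spoke_in seg'.
  + by case: (emp _ (drawn_seg _ _ _ uv' seg')); exact: spoke_in seg.
  + have Ez : z = z'.
      have [_ c1] := spoke_cases fG zabc seg; have [_ c2] := spoke_cases fG zabc' seg'.
      by case: c1 c2 => -[-> ?] [] [-> ?] //; exfalso; lra.
    by subst z'; case: Exy Euv => -[-> ->] [] [-> ->]; [left|right|right|left].
Qed.

(** The corners are listed counter-clockwise with the pair to be enriched first: [a b] for the rest
    of the path, [w b] and [a w] for the two new edges. *)
Lemma stack_faces (G : drawing) a b c A B C (w := order G) (W := centroid A B C) :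
  plane_drawing G -> face G a b c A B C ->
  [/\ face (stack G a b c) a b w A B W, face (stack G a b c) w b c W B C &
      face (stack G a b c) a w c A W C].
Proof.
move=> pG fG; have [[an bn cn] [aA bB cC] D0 emp] := fG.
have [D1 D2 D3] : [/\ det A B W = det A B C / 3, det W B C = det A B C / 3 &
                      det A W C = det A B C / 3]%R.
  by split; rewrite /det /W /centroid /=; field.
have dn p : drawn (stack G a b c) p ->
    ~ open_triangle A B W p /\ ~ open_triangle W B C p /\ ~ open_triangle A W C p.
  have [-> -> ->] := centroid_triangles A B C p.
  case/(stack_drawn pG fG) => [/emp|->|[z zabc seg]].
  - by rewrite /open_triangle; lra.
  - by have [-> -> ->] := det_centroid A B C; lra.
  - by have [_ []] := spoke_cases fG zabc seg; lra.
have ord : [/\ a < w.+1, b < w.+1, c < w.+1 & w < w.+1] by rewrite !ltnS leqnn !(ltnW an, ltnW bn, ltnW cn).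
have [oa ob oc ow] := ord.
have pl : [/\ place (stack G a b c) a = A, place (stack G a b c) b = B,
              place (stack G a b c) c = C & place (stack G a b c) w = W].
  by rewrite /= eqxx !ltn_eqF // aA bB cC.
have [pa pb pc pw] := pl.
by split; split; rewrite ?D1 ?D2 ?D3 //; try lra; move=> p /dn[? []].
Qed.

(** * Building rich pairs inside an empty triangle *)

Lemma rich_sub (V : eqType) (E E' : rel V) (N k : nat) (u v : V) :
  (forall x y, E x y -> E' x y) -> rich E N k u v -> rich E' N k u v.
Proof.
move=> EE'; elim: k u v => [|k IHk] u v //= [p [sp up ep pP]].
exists p; split=> //; first exact: sub_sorted ep.
by move=> x /pP[ux xv ru rv]; split; [exact: EE' | exact: EE' | exact: IHk | exact: IHk].
Qed.

Lemma enrich (N k : nat) (G : drawing) a b c A B C :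
  plane_drawing G -> face G a b c A B C ->
  exists G', [/\ plane_drawing G', extends G G' (open_triangle A B C) &
                 rich (edge G') N k a b].
Proof.
elim: k G a b c A B C => [|k IHk] G a b c A B C pG fG.
  by exists G; split=> //; exact: extends_refl.
(* Strengthened for induction: the path continues from the third corner [c], which is the previous
   path vertex after a step, and uses only new vertices, which yields distinctness. *)
suff [G' [p [pG' eG [sp up np ep pP]]]] : exists G' p,
    [/\ plane_drawing G', extends G G' (open_triangle A B C) &
      [/\ size p = N, uniq p, forall x, x \in p -> order G <= x, path (edge G') c p &
        forall x, x \in p ->
          [/\ edge G' a x, edge G' x b, rich (edge G') N k a x & rich (edge G') N k x b]]].
  by exists G'; split=> //; exists p; split=> //; exact: path_sorted ep.
(* Only the length of the path still to be built varies; the [N] inside [rich] stays fixed. *)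
elim: {1}N G c C pG fG => [|m IHm] G c C pG fG.
  by exists G, [::]; split=> //; exact: extends_refl.
set w := order G; set W := centroid A B C.
have pG1 := stack_plane pG fG; have eG1 := stack_extends pG fG.
have [fabw fwbc fawc] := stack_faces pG fG.
have edges1 : [/\ edge (stack G a b c) a w, edge (stack G a b c) w b &
                  edge (stack G a b c) c w].
  by rewrite /= eqxx !inE !eqxx ?orbT.
have [E1a E1b E1c] := edges1.
have regions p := centroid_triangles A B C p.
(* The three triangles are filled one after another; being disjoint, those still waiting remain
   faces. *)
have [G2 [pG2 eG2 r2]] := IHk _ _ _ _ _ _ _ pG1 fawc.
have fwbc2 : face G2 w b c W B C.
  by apply: face_extends fwbc eG2 _ => p; have [_ -> ->] := regions p; lra.
have [G3 [pG3 eG3 r3]] := IHk _ _ _ _ _ _ _ pG2 fwbc2.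
have fabw3 : face G3 a b w A B W.
  apply: (face_extends _ eG3); last by move=> p; have [-> -> _] := regions p; lra.
  by apply: (face_extends fabw eG2) => p; have [-> _ ->] := regions p; lra.
have [G4 [p [pG4 eG4 [sp up np ep pP]]]] := IHm _ _ _ pG3 fabw3.
have [o2 _ i2 _] := eG2; have [o3 _ i3 _] := eG3; have [o4 _ i4 _] := eG4.
have w4 x : x \in p -> w < x.
  by move/np; apply: leq_trans; apply: leq_trans o2 o3.
exists G4, (w :: p); split=> //.
- apply: (extends_trans eG1); last by move=> q; exact.
  apply: (extends_trans (S' := open_triangle A B W)); last first.
  + by move=> q; have [-> _ _] := regions q; rewrite /open_triangle; lra.
  + exact: eG4.
  apply: (extends_trans (S' := open_triangle W B C)); last first.
  + by move=> q; have [_ -> _] := regions q; rewrite /open_triangle; lra.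
  + exact: eG3.
  apply: (extends_trans (S' := open_triangle A W C) (extends_refl _ _)) => //.
  by move=> q; have [_ _ ->] := regions q; rewrite /open_triangle; lra.
- split=> /=.
  + by rewrite sp.
  + by rewrite up andbT; apply/negP => /w4; rewrite ltnn.
  + by move=> x; rewrite inE => /predU1P[->//|/w4/ltnW].
  + by rewrite ep andbT; apply/i4/i3/i2.
  + move=> x; rewrite inE => /predU1P[->|/pP//]; split.
    * exact/i4/i3/i2.
    * exact/i4/i3/i2.
    * exact: (rich_sub i4 (rich_sub i3 r2)).
    * exact: (rich_sub i4 r3).
Qed.

(** * From straight-line drawings to topological planarity *)

Lemma segment_arc (a b : pt) : a <> b -> Defs.arc (segment a b).
Proof.
move=> neq; split.
  move=> t eps _ eps0.
  (* A Lipschitz constant of the segment in the maximum norm; the summand 1 makes it visibly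
     positive. *)
  pose M := (1 + Rabs (b.1 - a.1) + Rabs (b.2 - a.2))%R.
  have M1 := Rabs_pos (b.1 - a.1); have M2 := Rabs_pos (b.2 - a.2).
  exists (eps / M)%R; split; first by apply: Rdiv_lt_0_compat; rewrite /M; lra.
  move=> s _ st.
  have E : (Rabs (s - t) * M < eps)%R.
    have -> : (eps = eps / M * M)%R by field; rewrite /M; lra.
    by apply: Rmult_lt_compat_r => //; rewrite /M; lra.
  have P := Rabs_pos (s - t).
  rewrite /dist2 /segment /=.
  have -> : ((1 - s) * a.1 + s * b.1 - ((1 - t) * a.1 + t * b.1) = (s - t) * (b.1 - a.1))%R.
    by ring.
  have -> : ((1 - s) * a.2 + s * b.2 - ((1 - t) * a.2 + t * b.2) = (s - t) * (b.2 - a.2))%R.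
    by ring.
  by rewrite !Rabs_mult; apply: Rmax_lub_lt; apply: Rle_lt_trans E;
     apply: Rmult_le_compat_l => //; rewrite /M; lra.
move=> s t _ _ [E1 E2].
have [//|st] := Req_dec s t.
have F (x y : R) : ((1 - s) * x + s * y = (1 - t) * x + t * y)%R -> x = y.
  by move=> E; apply: (Rmult_eq_reg_l (s - t)); lra.
by case: neq; case: a b E1 E2 => [a1 a2] [b1 b2] /= /F-> /F->.
Qed.

Lemma plane_drawing_planar (G : drawing) :
  plane_drawing G -> planar (fun x y : 'I_(order G) => edge G x y).
Proof.
move=> [En _ inj ev ee].
exists (fun x : 'I_(order G) => place G x),
  (fun x y : 'I_(order G) => segment (place G x) (place G y)).
have seg (x y : nat) t : in01o t -> open_segment (place G x) (place G y)
    (segment (place G x) (place G y) t) by exists t.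
split; last split; last split.
- by move=> x y /inj E; apply/val_inj/E.
- move=> x y xy; rewrite segment0 segment1; split=> //; apply: segment_arc.
  by move=> /inj E; have [? ? /eqP[]] := En x y xy; apply: E.
- by move=> x y z t xy t01; apply: (ev x y z) (seg _ _ _ t01).
- move=> x y u v t s xy uv /eqP neq t01 [s0 s1] E.
  have xyp := seg x y t t01; rewrite {}E in xyp.
  (* [planar] lets the second curve run over its endpoints too; these are vertices, which the first
     open segment avoids. *)
  have [Es|s0'] := Req_dec s 0.
    by apply: (ev x y u _ xy _ xyp) => //; rewrite Es segment0.
  have [Es|s1'] := Req_dec s 1.
    by apply: (ev x y v _ xy _ xyp) => //; rewrite Es segment1.
  have uvp : open_segment (place G u) (place G v) (segment (place G u) (place G v) s).
    by apply: seg; split; lra.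
  by apply: neq; have [[/val_inj-> /val_inj->]|[/val_inj-> /val_inj->]] := ee _ _ _ _ _ xy uv xyp uvp;
     rewrite // setUC.
Qed.

(** * The starting triangle and the resulting planar graph *)

Definition three_points : drawing :=
  Drawing 3 (fun x => match x with 0 => (0, 0) | 1 => (1, 0) | _ => (0, 1) end)%R
    (fun _ _ => false).

Lemma three_points_plane : plane_drawing three_points.
Proof.
split=> //= -[|[|[|//]]] [|[|[|//]]] _ _ // [] *; lra.
Qed.

Lemma three_points_face : face three_points 0 1 2 (0, 0)%R (1, 0)%R (0, 1)%R.
Proof.
split=> //=; first by rewrite /det /=; lra.
move=> p [[x x3 ->]|[x [y []//]]].
by case: x x3 => [|[|[|//]]] _; rewrite /open_triangle /det /=; lra.
Qed.

Theorem theorem4p5 :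
  forall c : nat,
  exists (VG : finType) (eG : rel VG),
    simple_graph eG /\ planar eG /\
    forall (VT : finType) (eT : rel VT) (VH : finType) (eH : rel VH),
      is_tree eT -> simple_graph eH ->
      contained eG (strong (strong eH eT) (Kc c)) ->
      contained (Kc 4) eH /\ tw_ge eH 3.
Proof.
move=> c.
have [G [pG [oG _ _ _] rG]] := enrich (ladder_length c) 4 three_points_plane three_points_face.
exists 'I_(order G), (fun x y : 'I_(order G) => edge G x y).
have [En E_sym _ _ _] := pG.
split; first by split=> [x y|x]; [exact: E_sym | apply/negP => /En[_ _]; rewrite eqxx].
split; first exact: plane_drawing_planar.
move=> VT eT VH eH tree simpH [f [finj fE]].
have coords := embedding_product_coords finj fE.
have o0 : 0 < order G by apply: leq_trans oG.
have o1 : 1 < order G by apply: leq_trans oG.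
have rG' : rich (fun x y : 'I_(order G) => edge G x y) (ladder_length c) 4
             (Ordinal o0) (Ordinal o1).
  by apply: (@rich_ord _ _ _ _ (Ordinal o0) (Ordinal o1) _ rG) => x y /En[].
have [x [y [z [w [xy xz xw [yz yw zw]]]]]] := very_rich_K4 coords tree rG'.
split; first exact: (K4_contained simpH) xy xz xw yz yw zw.
exact: (K4_tw_ge simpH.2 xy xz xw yz yw zw).
Qed.
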